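(* Given a finite number of discrete training data, i.e. $p^\star(x)=\frac1N\sum_{i=1}^N\delta(x-x^{(i)})$, if $p_\theta(x|z)=\mathrm{Bernoulli}(\mu_\theta(z))$, where the Bernoulli mean $\mu_\theta(z)$ is produced by the decoder, and $0<\mu_\theta^k(z)<1$ for each of its $k$-th dimensional output, then the optimal decoder $\mu_\theta(z)$ is $$\mu_\theta(z)=\sum_i w_i(z)\,x^{(i)},\qquad\text{where } w_i(z)=\frac{q_\phi(z|x^{(i)})}{\sum_j q_\phi(z|x^{(j)})}\ \text{ and }\ \sum_i w_i(z)=1.$$
   Context: The setting is a variational auto-encoder with observed variable $x$ (a vector with binary components $x_k$), latent variable $z\in\mathbb R^n$, prior density $p_\lambda(z)$, and variational posterior $q_\phi(z|x)$, which is a distribution of $z$ for each $x$. The points $x^{(1)},\dots,x^{(N)}$ are the training data and $p^\star(x)$ is their empirical distribution. The decoder is a neural network with parameter $\theta$, giving a continuous mapping $z\mapsto\mu_\theta(z)$ with components $\mu_\theta^k(z)$, and $$\mathrm{Bernoulli}(\mu_\theta(z))=\prod_k\left(\mu_\theta^k(z)\right)^{x_k}\left(1-\mu_\theta^k(z)\right)^{1-x_k}.$$ ''Optimal'' is meant with respect to the training objective (the expected evidence lower bound, to be maximized) $$\mathcal L=\mathbb E_{p^\star(x)}\,\mathbb E_{q_\phi(z|x)}\left[\log p_\theta(x|z)+\log p_\lambda(z)-\log q_\phi(z|x)\right],$$ regarded as a functional of the decoder $\mu_\theta$, with $q_\phi(z|x)$ and $p_\lambda(z)$ held fixed.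
   Formalization: It is assumed that some decoder has objective above −∞ (otherwise every decoder is optimal); the formula for the optimal decoder holds for almost every z with Σ_j q(z|x^(j)) > 0, and for every such z when the posterior densities at the data are continuous. *)

(* Defs.v *)
(* The latent space 'rV[R]_n carries the
   Borel sigma-algebra of its topology, and [lebesgue_rV R n] is the
   n-dimensional Lebesgue measure (see [lebesgue_rV_prod]), obtained by iterating
   the binary product measure on tuples. *)
From HB Require Import structures.
From mathcomp Require Import all_boot all_order all_algebra.
From mathcomp Require Import all_classical all_reals all_analysis.

Set Implicit Arguments.
Unset Strict Implicit.
Unset Printing Implicit Defensive.

Import Order.TTheory GRing.Theory Num.Theory.
Import numFieldNormedType.Exports.

Local Open Scope classical_set_scope.
Local Open Scope ring_scope.

Section lebesgue_cons.
Context (R : realType) (n : nat).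
Variable m : {sigma_finite_measure set (n.-tuple (measurableTypeR R)) -> \bar R}.

Definition cons_pair (p : measurableTypeR R * n.-tuple (measurableTypeR R)) :
  n.+1.-tuple (measurableTypeR R) := [the n.+1.-tuple _ of p.1 :: p.2].

Lemma measurable_cons_pair : measurable_fun [set: _] cons_pair.
Proof. exact: measurable_cons measurable_fst measurable_snd. Qed.

Definition lebesgue_cons : set (n.+1.-tuple (measurableTypeR R)) -> \bar R :=
  pushforward ((@lebesgue_measure R) \x m)%E cons_pair.

Let pf : {measure set (n.+1.-tuple (measurableTypeR R)) -> \bar R} :=
  measure_function_pushforward__canonical__measure_function_Measure
    ((@lebesgue_measure R) \x m)%E measurable_cons_pair.

Let lebesgue_cons0 : lebesgue_cons set0 = 0%E.
Proof. exact: (measure0 pf). Qed.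

Let lebesgue_cons_ge0 A : (0 <= lebesgue_cons A)%E.
Proof. exact: (measure_ge0 pf). Qed.

Let lebesgue_cons_sigma_additive : semi_sigma_additive lebesgue_cons.
Proof. exact: (@measure_semi_sigma_additive _ _ _ pf). Qed.

HB.instance Definition _ := isMeasure.Build _ _ _ lebesgue_cons
  lebesgue_cons0 lebesgue_cons_ge0 lebesgue_cons_sigma_additive.

Let lebesgue_cons_sigma_finite : sigma_finite setT lebesgue_cons.
Proof.
have /sigma_finiteP[F [TF ndF Foo]] := @sigma_finiteT _ _ R (@lebesgue_measure R).
have /sigma_finiteP[G [TG ndG Goo]] := @sigma_finiteT _ _ R m.
pose g (t : n.+1.-tuple (measurableTypeR R)) := (thead t, [tuple of behead t]).
have cK p : g (cons_pair p) = p.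
  by case: p => [a t]; rewrite /g /cons_pair /= theadE; congr pair; apply/val_inj.
have mg : measurable_fun setT g.
  apply/measurable_fun_pairP; split => /=.
    rewrite (_ : _ \o _ = fun t => tnth t ord0) //; exact: measurable_tnth.
  exact: measurable_behead.
exists (fun k => g @^-1` (F k `*` G k)).
  apply/esym/seteqP; split => // t _.
  have /= [i _ Fi] : (\bigcup_i F i) (g t).1 by rewrite -TF.
  have /= [j _ Gj] : (\bigcup_i G i) (g t).2 by rewrite -TG.
  exists (maxn i j) => //; split => /=.
    by move: Fi; exact/subsetPset/ndF/leq_maxl.
  by move: Gj; exact/subsetPset/ndG/leq_maxr.
move=> k; have [mF Fk] := Foo k; have [mG Gk] := Goo k; split.
  by rewrite -[X in measurable X]setTI; apply: mg => //; exact: measurableX.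
rewrite /lebesgue_cons /pushforward -comp_preimage.
rewrite (_ : g \o cons_pair = id); last by apply/funext => p; exact: cK.
by rewrite preimage_id product_measure1E// lte_mul_pinfty// ge0_fin_numE.
Qed.

HB.instance Definition _ := Measure_isSigmaFinite.Build _ _ _ lebesgue_cons
  lebesgue_cons_sigma_finite.

End lebesgue_cons.

Fixpoint lebesgue_tuple (R : realType) (n : nat) :
    {sigma_finite_measure set (n.-tuple (measurableTypeR R)) -> \bar R} :=
  match n with
  | 0 => dirac [tuple]
  | n'.+1 => lebesgue_cons (lebesgue_tuple R n')
  end.

HB.instance Definition _ (R : realType) (n : nat) :=
  @isMeasurable.Build (sigma_display (@open 'rV[R]_n)) 'rV[R]_n
    <<s (@open 'rV[R]_n) >>
    (@sigma_algebra0 _ setT _) (@sigma_algebraC _ _) (@sigma_algebra_bigcup _ setT _).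

Section lebesgue_rV.
Context (R : realType) (n : nat).

Definition rV_of_tuple (t : n.-tuple (measurableTypeR R)) : 'rV[R]_n :=
  \row_i (tnth t i : R).

Lemma measurable_rV_of_tuple : measurable_fun setT rV_of_tuple.
Proof.
have mball (c : 'rV[R]_n) (e : R) : 0 < e -> measurable (rV_of_tuple @^-1` ball c e).
  move=> e0.
  have -> : rV_of_tuple @^-1` ball c e =
      \bigcap_(i in [set: 'I_n])
        ((fun t : n.-tuple (measurableTypeR R) => tnth t i) @^-1` ball (c 0 i) e).
    apply/seteqP; split => [t [_ H] i _|t H].
      by have := H 0 i; rewrite mxE.
    by split => // j i; rewrite ord1 mxE; exact: H.
  apply: fin_bigcap_measurable => // i _.
  rewrite -[X in measurable X]setTI; apply: measurable_tnth => //.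
  by rewrite ball_itv; exact: measurable_itv.
apply: (@measurability _ _ _ _ _ _ (@open (matrix R 1 n)) erefl) => _ [A oA <-]; rewrite setTI.
pose I : Type := ('rV[rat]_n * nat)%type.
pose c (i : I) : 'rV[R]_n := map_mx ratr i.1.
pose F (i : I) : set (n.-tuple (measurableTypeR R)) :=
  if `[< ball (c i) (i.2.+1%:R^-1) `<=` A >]
  then rV_of_tuple @^-1` ball (c i) (i.2.+1%:R^-1) else set0.
have -> : rV_of_tuple @^-1` A = \bigcup_i F i.
  apply/seteqP; split => [t At|t [i _]]; last first.
    by rewrite /F; case: asboolP => // sA; exact: sA.
  have /nbhs_ballP[e /= e0 eA] : nbhs (rV_of_tuple t) A by exact: open_nbhs_nbhs.
  have [k ke] : exists k : nat, k.+1%:R^-1 < e / 2.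
    by have [k _ /(_ k (leqnn k))] := near_infty_natSinv_lt (PosNum (divr_gt0 e0 (ltr0Sn _ 1))); exists k.
  have k0 : 0 < k.+1%:R^-1 :> R by rewrite invr_gt0.
  have /choice[f fP] : forall i : 'I_n, exists q : rat, ball (tnth t i : R) (k.+1%:R^-1) (ratr q).
    move=> i; have := @dense_rat R (ball (tnth t i : R) (k.+1%:R^-1)).
    case; [by exists (tnth t i); exact: ballxx|exact: ball_open|].
    by move=> x [Bx [q _ qx]]; exists q; rewrite qx.
  have tc : ball (c (\row_i f i, k)) (k.+1%:R^-1) (rV_of_tuple t).
    by apply: ball_sym; split => // j i; rewrite !mxE; exact: fP.
  exists (\row_i f i, k) => //; rewrite /F; case: asboolP => // nA; apply: nA => y cy; apply: eA.
  apply: (@le_ball _ _ _ (k.+1%:R^-1 + k.+1%:R^-1)); last exact: ball_triangle (ball_sym tc) cy.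
  by rewrite (splitr e) lerD // ltW.
apply: countable_bigcupT_measurable; first exact: countableP.
by move=> i; rewrite /F; case: ifP => // _; apply: mball.
Qed.

Definition lebesgue_rV : set 'rV[R]_n -> \bar R :=
  pushforward (lebesgue_tuple R n) rV_of_tuple.

Let pf : {measure set 'rV[R]_n -> \bar R} :=
  measure_function_pushforward__canonical__measure_function_Measure
    (lebesgue_tuple R n) measurable_rV_of_tuple.

Let lebesgue_rV0 : lebesgue_rV set0 = 0%E.
Proof. exact: (measure0 pf). Qed.

Let lebesgue_rV_ge0 A : (0 <= lebesgue_rV A)%E.
Proof. exact: (measure_ge0 pf). Qed.

Let lebesgue_rV_sigma_additive : semi_sigma_additive lebesgue_rV.
Proof. exact: (@measure_semi_sigma_additive _ _ _ pf). Qed.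

HB.instance Definition _ := isMeasure.Build _ _ _ lebesgue_rV
  lebesgue_rV0 lebesgue_rV_ge0 lebesgue_rV_sigma_additive.

End lebesgue_rV.
Arguments lebesgue_rV : clear implicits.

Lemma lebesgue_tuple_prod (R : realType) (n : nat)
    (B : 'I_n -> set (measurableTypeR R)) : (forall i, measurable (B i)) ->
  lebesgue_tuple R n [set t | forall i, B i (tnth t i)] =
  (\prod_(i < n) @lebesgue_measure R (B i))%E.
Proof.
elim: n B => [|n IHn] B mB.
  rewrite big_ord0 /= diracE mem_set //; first by move=> [].
rewrite big_ord_recl -IHn //= /lebesgue_cons /pushforward.
set S := [set t | forall i : 'I_n, _ _].
have mS : measurable S.
  have -> : S = \bigcap_(i in [set: 'I_n])
      ((fun t : n.-tuple (measurableTypeR R) => tnth t i) @^-1` B (lift ord0 i)).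
    by apply/seteqP; split => [t H i _|t H i]; exact: H.
  apply: fin_bigcap_measurable => // i _.
  rewrite -[X in measurable X]setTI; exact: measurable_tnth.
rewrite -product_measure1E //; congr (_ _).
apply/seteqP; split => [[a t] /= H|[a t] /= [Ba St] i].
  split => /=; first by have := H ord0; rewrite tnth0.
  by move=> i; have := H (lift ord0 i); rewrite tnthS.
by case: (unliftP ord0 i) => [j ->|->]; rewrite ?tnthS ?tnth0 //; exact: St.
Qed.

Lemma lebesgue_rV_prod (R : realType) (n : nat)
    (B : 'I_n -> set (measurableTypeR R)) : (forall i, measurable (B i)) ->
  lebesgue_rV R n [set z | forall i, B i (z 0 i)] =
  (\prod_(i < n) @lebesgue_measure R (B i))%E.
Proof.
move=> mB; rewrite -lebesgue_tuple_prod //; congr (lebesgue_tuple _ _ _).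
by apply/seteqP; split => t H i; have := H i; rewrite /= mxE.
Qed.

Section empirical.
Context (R : realType) (d : measure_display) (T : measurableType d) (N : nat).
Variable x : 'I_N -> T.

Definition empirical (A : set T) : \bar R :=
  (N%:R^-1%:E * \sum_(i < N) \d_(x i) A)%E.

Let pf : {measure set T -> \bar R} :=
  mscale (N%:R^-1)%:nng
    (msum (fun k => if insub k is Some i then dirac (x i) : {measure set T -> \bar R}
                    else @mzero _ _ R) N).

Let pfE : empirical = pf.
Proof.
apply/funext => A; rewrite /pf /= /mscale /msum /empirical /=.
by congr (_ * _)%E; apply: eq_bigr => i _; rewrite valK.
Qed.

Let empirical0 : empirical set0 = 0%E.
Proof. by rewrite pfE measure0. Qed.

Let empirical_ge0 A : (0 <= empirical A)%E.
Proof. by rewrite pfE measure_ge0. Qed.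

Let empirical_sigma_additive : semi_sigma_additive empirical.
Proof. by rewrite pfE; exact: measure_semi_sigma_additive. Qed.

HB.instance Definition _ := isMeasure.Build _ _ _ empirical
  empirical0 empirical_ge0 empirical_sigma_additive.

End empirical.
Arguments empirical R {d T N} x A.

Section vae.
Context (R : realType) (n K : nat).
Implicit Types (mu : 'rV[R]_n -> 'rV[R]_K) (x : K.-tuple bool) (z : 'rV[R]_n).

Definition is_density (f : 'rV[R]_n -> R) : Prop :=
  [/\ measurable_fun setT f, forall z, 0 <= f z &
      (\int[lebesgue_rV R n]_z (f z)%:E = 1)%E].

Definition obs_vec x : 'rV[R]_K := \row_k ((tnth x k : nat)%:R).

Definition bernoulli_lik (m : 'rV[R]_K) x : R :=
  \prod_(k < K) (m 0 k ^+ tnth x k * (1 - m 0 k) ^+ (1 - tnth x k)).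

Definition is_decoder mu : Prop :=
  continuous mu /\ forall z k, 0 < mu z 0 k < 1.

(* [lne] is the extended logarithm, with [lne 0 = -oo]; the integral against
   q(z|x) dz ignores the points where q(z|x) = 0, as 0 * y = 0 in [\bar R]. *)
Definition elbo (p : 'rV[R]_n -> R) (q : K.-tuple bool -> 'rV[R]_n -> R)
    mu x : \bar R :=
  (\int[lebesgue_rV R n]_z ((q x z)%:E *
     (lne (bernoulli_lik (mu z) x)%:E + lne (p z)%:E - lne (q x z)%:E)))%E.

Definition objective (pstar : set (K.-tuple bool) -> \bar R)
    (p : 'rV[R]_n -> R) (q : K.-tuple bool -> 'rV[R]_n -> R) mu : \bar R :=
  (\int[pstar]_x elbo p q mu x)%E.

Definition is_optimal_decoder (pstar : set (K.-tuple bool) -> \bar R)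
    (p : 'rV[R]_n -> R) (q : K.-tuple bool -> 'rV[R]_n -> R) mu : Prop :=
  is_decoder mu /\
  forall nu, is_decoder nu ->
    (objective pstar p q nu <= objective pstar p q mu)%E.

(* Meaningful only where the denominator is nonzero. *)
Definition weight (N : nat) (x : 'I_N -> K.-tuple bool)
    (q : K.-tuple bool -> 'rV[R]_n -> R) (i : 'I_N) z : R :=
  q (x i) z / \sum_(j < N) q (x j) z.

End vae.

(* Main.v *)
(* Up to a finite constant, the objective is minus (1/N times) the integral of
   [\sum_i q(z|x_i) * - log p(x_i|z)] (the posterior/prior part is a constant,
   finite because some decoder has a finite objective, and both parts can be
   written as integrals of nonnegative functions).
   The pointwise maximizer of the log-likelihood sum is characterized by the
   vanishing of the residuals [\sum_i q(z|x_i) (x_i - mu(z))_k].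
   If they vanish almost everywhere, concavity of the logarithm gives optimality.
   Conversely, perturbing the k-th mean of an optimal decoder by
   [t psi(z) mu_k(z) (1 - mu_k(z))], with psi continuous and bounded by 1, yields a
   decoder, and letting t tend to 0 shows that the k-th residual is orthogonal to
   every such psi, hence vanishes almost everywhere.
   When the posteriors are continuous the residuals are continuous too, and
   nonempty open sets have positive Lebesgue measure. *)
Require Import Defs.
From HB Require Import structures.
From mathcomp Require Import all_boot all_order all_algebra.
From mathcomp Require Import all_classical all_reals all_analysis.
From mathcomp Require Import measurable_realfun ring lra.

Set Implicit Arguments.
Unset Strict Implicit.
Unset Printing Implicit Defensive.

Import Order.TTheory GRing.Theory Num.Theory.
Import numFieldNormedType.Exports.

Local Open Scope classical_set_scope.
Local Open Scope ring_scope.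

(** * The Borel space of row vectors *)

Lemma open_measurable_rV (R : realType) (n : nat) (U : set 'rV[R]_n) :
  open U -> measurable U.
Proof. by move=> oU; apply: sub_sigma_algebra. Qed.

Lemma continuous_measurable_rV (R : realType) (n : nat) (f : 'rV[R]_n -> R) :
  continuous f -> measurable_fun setT f.
Proof.
move=> /continuousP cf; apply: (measurability _ (RGenOpens.measurableE R)).
move=> _ [_ [a [b ->] <-]]; rewrite setTI; apply: open_measurable_rV.
exact/cf/interval_open.
Qed.

(** The function is one minus the contracted distance to [C]. Contracting keeps it in [0, 1] even
    when [C] is empty and the distance is infinite; closedness makes the distance positive off
    [C]. *)
Lemma closed_peak_function (R : realType) (T : pseudoMetricType R) (C : set T) :
  closed C -> exists e : T -> R,
  [/\ continuous e, forall z, 0 <= e z <= 1, forall z, C z -> e z = 1 &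
      forall z, ~ C z -> e z < 1].
Proof.
move=> cC; pose d (z : T) := contract (edist_inf C z).
have d0 z : 0 <= d z by rewrite -[leLHS]contract0 le_contract edist_inf_ge0.
exists (fun z => 1 - d z); split.
- move=> z; apply: continuousB; first exact: cvg_cst.
  apply: (continuous_comp (@edist_inf_continuous _ _ C z)).
  apply/cvgrPdist_lt => r r0.
  exact: (nbhsx_ballx (edist_inf C z) r r0).
- move=> z; rewrite subr_ge0 lerBlDr lerDl d0 andbT.
  by rewrite (le_trans (ler_norm _))// contract_le1.
- by move=> z Cz; rewrite /d edist_inf0// contract0 subr0.
- move=> z nCz; rewrite ltrBlDr ltrDl -[ltLHS]contract0 lt_contract.
  have /nbhs_ballP[r /= r0 rC] : nbhs z (~` C).
    by apply: open_nbhs_nbhs; split => //; exact: closed_openC.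
  apply: (@lt_le_trans _ _ r%:E); first by rewrite lte_fin.
  apply: le_ereal_inf_tmp => _ [a Ca <-]; rewrite leNgt; apply/negP.
  by move=> /edist_lt_ball /rC; apply.
Qed.

(* With e the peak function of a closed set C, testing against the powers of e
   and dominated convergence give [\int_C h = 0]; the sets over which h has zero
   integral form a lambda-system. *)
Lemma integral_eq0_rV (R : realType) (n : nat)
    (m : {measure set 'rV[R]_n -> \bar R}) (h : 'rV[R]_n -> R) :
  m.-integrable setT (EFin \o h) ->
  (forall psi : 'rV[R]_n -> R, continuous psi -> (forall z, `|psi z| <= 1) ->
    (\int[m]_z (psi z * h z)%:E = 0)%E) ->
  {ae m, forall z, h z = 0}.
Proof.
move=> hi hpsi.
have mh : measurable_fun setT h by apply/measurable_EFinP; exact: measurable_int hi.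
(* Test against the constant 1; this zero total makes the class of sets with zero integral stable
   under complements. *)
have hT : (\int[m]_z (h z)%:E = 0)%E.
  have c1 : continuous (fun _ : 'rV[R]_n => 1 : R) by move=> z; apply: cst_continuous.
  rewrite -(hpsi _ c1) => [|z]; last by rewrite /= normr1 lexx.
  by apply: eq_integral => z _; rewrite mul1r.
have hC (A : set 'rV[R]_n) : measurable A -> (\int[m]_(z in A) (h z)%:E = 0)%E ->
    (\int[m]_(z in ~` A) (h z)%:E = 0)%E.
  move=> mA A0; move: hT.
  rewrite -(setUv A) integral_setU_EFin//; first by rewrite A0 add0e.
  - exact: measurableC.
  - by rewrite setUv.
  - by rewrite disj_set2E setICr eqxx.
have hclosed C : closed C -> (\int[m]_(z in C) (h z)%:E = 0)%E.
  move=> cC; have [e [ce e01 eC enC]] := closed_peak_function cC.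
  have mC : measurable C.
    by rewrite -[C]setCK; apply: measurableC; apply: open_measurable_rV; exact: closed_openC.
  have ck k : continuous (fun z => e z ^+ k).
    move=> z; apply: (@continuous_comp _ _ _ e (fun x : R => x ^+ k)); first exact: ce.
    exact: exprn_continuous.
  have ek1 k z : `|e z ^+ k| <= 1.
    have /andP[e0 e1] := e01 z.
    by rewrite ger0_norm ?exprn_ge0// exprn_ile1.
  pose F k z := ((e z ^+ k * h z)%:E : \bar R).
  have [|||||_ _] := @dominated_convergence _ _ R m setT measurableT F
     (fun z => (\1_C z * h z)%:E) (fun z => `|h z|%:E).
  + move=> k; apply/measurable_EFinP; apply: measurable_funM => //.
    exact: continuous_measurable_rV.
  + by apply/measurable_EFinP; apply: measurable_funM => //; exact: measurable_indic.
  + apply: aeW => z _; apply: cvg_EFin; first exact: nearW.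
    rewrite /F /=; apply: cvgMl.
    rewrite indicE; have [|] := boolP (z \in C).
      rewrite inE => Cz; apply: cvg_near_cst; apply: nearW => k.
      by rewrite eC// expr1n.
    move=> /negP; rewrite inE => Cz; apply: cvg_expr.
    by have /andP[e0 _] := e01 z; rewrite ger0_norm// enC.
  + exact: integrable_norm.
  + apply: aeW => z k _; rewrite /F lee_fin normrM; apply: ler_piMl => //.
  + rewrite (_ : (fun k => _) = cst 0%E); last first.
      by apply/funext => k; apply: hpsi.
    move=> /(cvg_unique (@ereal_hausdorff R) (cvg_cst 0%E)) ->.
    rewrite [LHS]integral_mkcond; apply: eq_integral => z _.
    by rewrite patchE indicE; case: (z \in C); rewrite ?mul1r ?mul0r.
have hall A : measurable A -> (\int[m]_(z in A) (h z)%:E = 0)%E.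
  (* The open sets are stable under intersection and generate the Borel sets. *)
  apply: (@dynkin_induction _ _ (@open 'rV[R]_n)
    (fun A => \int[m]_(z in A) (h z)%:E = 0)%E) => //.
  - exact: openI.
  - move=> U oU; rewrite -[U]setCK; apply: hC.
      by apply: measurableC; exact: open_measurable_rV.
    by apply: hclosed; exact: open_closedC.
  - move=> F mF tF F0; rewrite integral_bigcup//.
      by rewrite eseries0 => [|i _ _]; [|exact: F0].
    by apply: integrableS hi => //; exact: bigcup_measurable.
have : ae_eq m setT (EFin \o h) (cst 0%E).
  apply: integral_ae_eq => // E _ mE; rewrite integral0; exact: hall.
by apply: filterS => z /(_ I) [].
Qed.

(** A ball of ['rV[R]_n] is a cube, so its measure is a product of positive side lengths, equal to 1
    when [n] is 0. *)
Lemma lebesgue_rV_open_gt0 (R : realType) (n : nat) (U : set 'rV[R]_n) (z : 'rV[R]_n) :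
  open U -> U z -> (0 < lebesgue_rV R n U)%E.
Proof.
move=> oU Uz.
have /nbhs_ballP[e /= e0 eU] : nbhs z U by exact: open_nbhs_nbhs.
pose B (i : 'I_n) : set (measurableTypeR R) := ball (z 0 i) e.
have mB i : measurable (B i) by rewrite /B ball_itv; exact: measurable_itv.
have bE : ball z e = [set y : 'rV[R]_n | forall i, B i (y 0 i)].
  apply/seteqP; split => [y [_ zy] i|y zy]; first exact: zy.
  by split => // j i; rewrite ord1; exact: zy.
apply: (@lt_le_trans _ _ (lebesgue_rV R n (ball z e))).
  rewrite bE lebesgue_rV_prod//; elim/big_ind : _ => //.
    exact: mule_gt0.
  move=> i _; rewrite /B lebesgue_measure_ball ?ltW// lte_fin mulrn_wgt0//.
apply: le_measure => //; rewrite inE; apply: open_measurable_rV => //.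
exact: ball_open.
Qed.

Lemma continuous_ae_eq0 (R : realType) (n : nat) (h : 'rV[R]_n -> R) :
  continuous h -> {ae lebesgue_rV R n, forall z, h z = 0} -> forall z, h z = 0.
Proof.
move=> /continuousP ch [A [mA A0 hA]] z; apply: contrapT => hz.
have oU : open (h @^-1` [set y | y != 0]) by apply: ch; exact: open_neq.
have /lt_geF := lebesgue_rV_open_gt0 oU (introN eqP hz).
rewrite -A0 le_measure ?inE//; first exact: open_measurable_rV.
by move=> y /eqP hy; exact: hA.
Qed.

(** Linearity for integrable functions covers a finite integral of [C]. If that integral is
    infinite, [C <= |f| + F^-] forces the negative part of [F = f - C] to have infinite integral,
    while its positive part is at most [|f|]; both sides are then [-oo]. *)
Lemma integral_nonnegB d (T : measurableType d) (R : realType)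
    (m : {measure set T -> \bar R}) (f : T -> R) (C : T -> \bar R) :
  m.-integrable setT (EFin \o f) -> measurable_fun setT C ->
  (forall z, 0 <= C z)%E ->
  (\int[m]_z ((f z)%:E - C z) = \int[m]_z (f z)%:E - \int[m]_z C z)%E.
Proof.
move=> fi mC C0.
have [Coo|] := ltP (\int[m]_z C z)%E +oo%E.
  rewrite integralB//; apply/integrableP; split => //.
  by under eq_integral do rewrite gee0_abs//.
rewrite leye_eq => /eqP Coo.
have mf : measurable_fun setT (EFin \o f) by exact: measurable_int fi.
pose F z := ((f z)%:E - C z)%E.
have mF : measurable_fun setT F by exact: emeasurable_funB.
have ffin := integrable_fin_num measurableT fi.
have absfoo : (\int[m]_z `|(f z)%:E| < +oo)%E by have /integrableP[] := fi.
have Fpos : (\int[m]_z F^\+ z < +oo)%E.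
  apply: le_lt_trans absfoo; apply: ge0_le_integral => //.
  - exact: measurable_funepos.
  - exact: measurableT_comp.
  - move=> z _; rewrite funeposE ge_max abse_ge0 andbT.
    by apply: (le_trans _ (lee_abs _)); rewrite -[leRHS]sube0 leeB.
have Fneg : (\int[m]_z F^\- z = +oo)%E.
  apply/eqP; rewrite -leye_eq -Coo.
  have : (\int[m]_z C z <= \int[m]_z (`|(f z)%:E| + F^\- z))%E.
    apply: ge0_le_integral => //.
    - by apply: emeasurable_funD; [exact: measurableT_comp|exact: measurable_funeneg].
    - move=> z _; have : (- F z <= F^\- z)%E by rewrite funenegE le_max lexx.
      move/(leeD2l `|(f z)%:E|%E); apply: le_trans.
      rewrite /F oppeD ?fin_num_adde_defr// oppeK addeA -[leLHS]add0e leeD2r//.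
      by rewrite -EFinN/= -EFinD lee_fin subr_ge0 ler_norm.
  rewrite ge0_integralD//; [|exact: measurableT_comp|exact: measurable_funeneg].
  rewrite Coo leye_eq; case: (\int[m]_z F^\- z)%E (integral_ge0 m (fun z (_ : setT z) => funeneg_ge0 F z)) => [r _||]//.
  by move: absfoo; case: (\int[m]_z `|(f z)%:E|)%E => [s||].
rewrite [LHS]integralE Fneg Coo addeC addNye ?addeNy//.
Qed.

(** * The Bernoulli log-likelihood *)

(** Apply [ln t <= t - 1] to [t = (1 + u)^-1]. The error depends on [v] only, hence is uniform in
    [u]. *)
Lemma ln_ge_sub_sqr (R : realType) (u v : R) :
  `|u| <= v -> v <= 2^-1 -> u - 2 * v ^+ 2 <= ln (1 + u).
Proof.
rewrite ler_norml => /andP[uv vu] v2.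
have u0 : 0 < 1 + u by lra.
have -> : ln (1 + u) = - ln (1 + u)^-1 by rewrite lnV ?opprK// posrE.
have h : ln (1 + u)^-1 <= (1 + u)^-1 - 1.
  have := @le_ln1Dx R ((1 + u)^-1 - 1).
  rewrite (addrC 1 (_ - _)) subrK; apply; by rewrite ltrBrDr addrC subrr invr_gt0.
have [i [iu i0]] : exists i, (1 + u) * i = 1 /\ (1 + u)^-1 = i.
  by exists (1 + u)^-1; rewrite divff// gt_eqF.
rewrite i0 in h; have ip : 0 < i by rewrite -i0 invr_gt0.
(* From [u >= - 2^-1]; this is the source of the constant 2, since [1 - i = u - u ^+ 2 * i]. *)
have i2 : i <= 2 by nra.
have -> : ln (1 + u)^-1 = ln i by rewrite i0.
have uE : 1 - i = u * i by lra.
have : u * i = u - u ^+ 2 * i by nra.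
nra.
Qed.

Section bernoulli.
Context (R : realType) (K : nat).
Implicit Types (m : 'rV[R]_K) (y : K.-tuple bool).

Lemma obs_vecE y k : obs_vec R y 0 k = (tnth y k)%:R.
Proof. by rewrite mxE. Qed.

Lemma bernoulli_lik_gt0 m y : (forall k, 0 < m 0 k < 1) -> 0 < bernoulli_lik m y.
Proof.
move=> m01; rewrite /bernoulli_lik; elim/big_ind : _ => //; first exact: mulr_gt0.
move=> k _; have /andP[m0 m1] := m01 k.
by rewrite mulr_gt0// exprn_gt0// subr_gt0.
Qed.

Lemma ln_bernoulli_lik m y : (forall k, 0 < m 0 k < 1) ->
  ln (bernoulli_lik m y) =
  \sum_(k < K) (if tnth y k then ln (m 0 k) else ln (1 - m 0 k)).
Proof.
move=> m01; rewrite /bernoulli_lik.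
(* Positivity of the partial products is carried along because [lnM] requires it. *)
pose P (a b : R) := 0 < a /\ ln a = b.
suff [] : P (\prod_(k < K) (m 0 k ^+ tnth y k * (1 - m 0 k) ^+ (1 - tnth y k)))
  (\sum_(k < K) (if tnth y k then ln (m 0 k) else ln (1 - m 0 k))) by [].
elim/big_ind2 : _ => [|a b c d [a0 <-] [c0 <-]|k _].
- by split => //; rewrite ln1.
- by split; [exact: mulr_gt0|rewrite lnM// posrE].
- have /andP[m0 m1] := m01 k.
  case: (tnth y k); rewrite /P /= ?expr0 ?expr1 ?mulr1 ?mul1r; split => //.
  by rewrite subr_gt0.
Qed.

Lemma ln_bernoulli_lik_le0 m y : (forall k, 0 < m 0 k < 1) ->
  ln (bernoulli_lik m y) <= 0.
Proof.
move=> m01; rewrite ln_bernoulli_lik//; apply: sumr_le0 => k _.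
by have /andP[m0 m1] := m01 k; case: ifP => _; apply: ln_le0; lra.
Qed.

(* The right-hand side is the tangent at m of the concave log-likelihood. *)
Lemma ln_bernoulli_lik_tangent m m' y :
  (forall k, 0 < m 0 k < 1) -> (forall k, 0 < m' 0 k < 1) ->
  ln (bernoulli_lik m' y) <= ln (bernoulli_lik m y) +
    \sum_(k < K) (m' 0 k - m 0 k) / (m 0 k * (1 - m 0 k)) *
                 (obs_vec R y 0 k - m 0 k).
Proof.
move=> m01 m'01; rewrite !ln_bernoulli_lik// -big_split/=; apply: ler_sum => k _.
have /andP[a0 a1] := m01 k; have /andP[b0 b1] := m'01 k.
have tan (a b : R) : 0 < a -> 0 < b -> ln b <= ln a + (b - a) / a.
  move=> {}a0 {}b0; rewrite -lerBlDl -ln_div ?posrE//.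
  have -> : b / a = 1 + (b - a) / a by field; rewrite gt_eqF.
  apply: le_ln1Dx; rewrite mulrBl divff ?gt_eqF// ltrBrDr addrC subrr.
  exact: divr_gt0.
(* The score [(y_k - m_k) / (m_k (1 - m_k))] is [1 / m_k] for a true bit and [- 1 / (1 - m_k)] for a
   false one, so the cases are tangents of [ln] at [m_k] and at [1 - m_k]. *)
rewrite obs_vecE; case: (tnth y k) => /=.
  rewrite [X in _ <= _ + X](_ : _ = (m' 0 k - m 0 k) / m 0 k); first exact: tan.
  by field; lra.
rewrite [X in _ <= _ + X](_ : _ = ((1 - m' 0 k) - (1 - m 0 k)) / (1 - m 0 k)).
  by apply: tan; rewrite subr_gt0.
by field; lra.
Qed.

(* The factor [m 0 k * (1 - m 0 k)] keeps the perturbed mean in (0, 1) and cancels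
   the denominator of the score, so that the bound is uniform in m. *)
Lemma ln_bernoulli_lik_perturb m k (u v : R) y :
  (forall k, 0 < m 0 k < 1) -> `|u| <= v -> v <= 2^-1 ->
  let m' := m + (u * (m 0 k * (1 - m 0 k))) *: delta_mx 0 k in
  (forall k, 0 < m' 0 k < 1) /\
  ln (bernoulli_lik m y) + u * (obs_vec R y 0 k - m 0 k) - 2 * v ^+ 2
    <= ln (bernoulli_lik m' y).
Proof.
move=> m01 uv v2 m'.
have m'E j : m' 0 j = m 0 j + (u * (m 0 k * (1 - m 0 k))) * (j == k)%:R.
  by rewrite !mxE eqxx.
(* For either value of the bit, its probability is multiplied by [1 + w] with [w = u (y_k - m_k)],
   and [|w| <= v]. *)
have m'k : m' 0 k = m 0 k * (1 + u * (1 - m 0 k)) by rewrite m'E eqxx/=; ring.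
have m'k1 : 1 - m' 0 k = (1 - m 0 k) * (1 - u * m 0 k) by rewrite m'E eqxx/=; ring.
have m'j j : j != k -> m' 0 j = m 0 j by move=> /negbTE jk; rewrite m'E jk mulr0 addr0.
have /andP[a0 a1] := m01 k.
have u1 : `|u * (1 - m 0 k)| <= v.
  have p : 0 <= 1 - m 0 k by rewrite subr_ge0 ltW.
  by rewrite normrM (ger0_norm p); apply: (le_trans _ uv); rewrite ler_piMr// gerBl ltW.
have u2 : `|- (u * m 0 k)| <= v.
  by rewrite normrN normrM (gtr0_norm a0); apply: (le_trans _ uv); rewrite ler_piMr// ltW.
have p1 : 0 < 1 + u * (1 - m 0 k) by move: u1; rewrite ler_norml => /andP[]; lra.
have p2 : 0 < 1 - u * m 0 k by move: u2; rewrite ler_norml => /andP[]; lra.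
have m'01 j : 0 < m' 0 j < 1.
  have [->|jk] := eqVneq j k; last by rewrite m'j.
  by rewrite m'k mulr_gt0//= -m'k -subr_gt0 m'k1 mulr_gt0// subr_gt0.
split => //; rewrite !ln_bernoulli_lik// (bigD1 k)//= [leRHS](bigD1 k)//=.
set A := \sum_(_ | _) _; set B := \sum_(_ | _) _.
have -> : A = B by apply: eq_bigr => j jk; rewrite m'j.
rewrite -!addrA addrCA (addrC _ B) lerD2l obs_vecE addrA.
case: (tnth y k) => /=.
  rewrite m'k lnM ?posrE// -addrA lerD2l; exact: ln_ge_sub_sqr.
rewrite m'k1 lnM ?posrE//; last by rewrite subr_gt0.
rewrite -addrA lerD2l sub0r mulrN.
exact: ln_ge_sub_sqr.
Qed.

End bernoulli.

(** * The objective as a sum of nonnegative integrals *)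

Lemma measurable_lne_EFin d (T : measurableType d) (R : realType) (f : T -> R) :
  measurable_fun setT f -> measurable_fun setT (fun z => lne (f z)%:E).
Proof.
move=> mf; apply: measurable_fun_ifT => /=.
- exact: measurable_fun_ler.
- exact: measurable_cst.
- by apply/measurable_EFinP; exact: measurableT_comp.
Qed.

Lemma is_density_integrable (R : realType) (n : nat) (f : 'rV[R]_n -> R) :
  is_density f -> (lebesgue_rV R n).-integrable setT (EFin \o f).
Proof.
move=> [mf f0 f1]; apply/integrableP; split; first exact/measurable_EFinP.
under eq_integral do rewrite gee0_abs ?lee_fin//.
by rewrite f1 ltry.
Qed.

Lemma ge0_integral_empirical (R : realType) d (T : measurableType d) (N : nat)
    (x : 'I_N -> T) (f : T -> \bar R) :
  measurable_fun setT f -> (forall y, 0 <= f y)%E ->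
  (\int[empirical R x]_y f y = N%:R^-1%:E * \sum_(i < N) f (x i))%E.
Proof.
move=> mf f0.
(* [msum] takes a sequence of measures indexed by [nat], so the Dirac masses are extended by the
   zero measure. *)
pose m := fun k => if insub k is Some i then dirac (x i) : {measure set T -> \bar R}
                   else @mzero _ _ R.
have -> : empirical R x = mscale (N%:R^-1)%:nng (msum m N).
  apply/funext => A; rewrite /mscale /msum /empirical /=.
  by congr (_ * _)%E; apply: eq_bigr => i _; rewrite /m valK.
rewrite ge0_integral_mscale//= ge0_integral_measure_sum//; congr (_ * _)%E.
by apply: eq_bigr => i _; rewrite /m valK integral_dirac// diracT mul1e.
Qed.

(** The space is finite and its singletons are finite intersections of coordinate preimages, so
    every subset is measurable. *)
Lemma measurable_tuple_bool (K : nat) d (T : measurableType d)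
    (f : K.-tuple bool -> T) : measurable_fun setT f.
Proof.
move=> _ Y mY; rewrite setTI; apply: countable_measurable => [t|]; last first.
  exact: sub_countable (subset_card_le (subsetT _)) (countableP _).
have -> : [set t] = \bigcap_(i in [set: 'I_K])
    ((fun s : K.-tuple bool => tnth s i) @^-1` [set tnth t i]).
  apply/seteqP; split => [_ -> i _//|s st].
  by apply: eq_from_tnth => i; exact: st.
apply: fin_bigcap_measurable => // i _.
by rewrite -[X in measurable X]setTI; apply: measurable_tnth.
Qed.

Section objective.
Context (R : realType) (n K N : nat) (x : 'I_N -> K.-tuple bool).
Context (p : 'rV[R]_n -> R) (q : K.-tuple bool -> 'rV[R]_n -> R).
Implicit Types (mu nu : 'rV[R]_n -> 'rV[R]_K) (z : 'rV[R]_n) (y : K.-tuple bool).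
Local Notation leb := (lebesgue_rV R n).

Definition nll mu y z : R := q y z * - ln (bernoulli_lik (mu z) y).

Definition total_nll mu z : R := \sum_(i < N) nll mu (x i) z.

(* The nonnegative integrand [p - q - q log (p / q)] of the Kullback-Leibler
   divergence of q from p. *)
Definition kl_gap y z : \bar R :=
  ((p z - q y z)%:E - (q y z)%:E * (lne (p z)%:E - lne (q y z)%:E))%E.

Context (p_density : is_density p) (q_density : forall y, is_density (q y)).

Let p_ge0 z : 0 <= p z. Proof. by have [_ ? _] := p_density. Qed.
Let q_ge0 y z : 0 <= q y z. Proof. by have [_ ? _] := q_density y. Qed.
Let mp : measurable_fun setT p. Proof. by have [] := p_density. Qed.
Let mq y : measurable_fun setT (q y). Proof. by have [] := q_density y. Qed.

(** This is [ln t <= t - 1] at [t = p / q], multiplied by [q]. Where [q = 0] the gap is [p]; where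
    [p = 0 < q] it is [+oo]. *)
Lemma kl_gap_ge0 y z : (0 <= kl_gap y z)%E.
Proof.
rewrite /kl_gap; have [->|q0] := eqVneq (q y z) 0.
  by rewrite mul0e sube0 subr0 lee_fin.
have {}q0 : 0 < q y z by rewrite lt0r q0 q_ge0.
have [->|p0] := eqVneq (p z) 0.
  by rewrite le0_lneNy// lne_EFin// gt0_muleNy ?lte_fin//= leey.
have {}p0 : 0 < p z by rewrite lt0r p0 p_ge0.
rewrite !lne_EFin// -EFinB lee_fin subr_ge0 -ln_div ?posrE//.
have -> : p z - q y z = q y z * (p z / q y z - 1) by field; rewrite gt_eqF.
rewrite ler_pM2l// -[in leLHS](subrK 1 (p z / q y z)) addrC; apply: le_ln1Dx.
by rewrite ltrBrDr addrC subrr divr_gt0.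
Qed.

Lemma measurable_kl_gap y : measurable_fun setT (kl_gap y).
Proof.
apply: emeasurable_funB; first exact/measurable_EFinP/measurable_funB.
apply: emeasurable_funM; first exact/measurable_EFinP.
by apply: emeasurable_funB; exact: measurable_lne_EFin.
Qed.

Lemma measurable_decoder mu k : is_decoder mu -> measurable_fun setT (fun z => mu z 0 k).
Proof.
move=> [cmu _]; apply: continuous_measurable_rV => z.
apply: (@continuous_comp _ _ _ mu (fun m : 'rV[R]_K => m 0 k)); first exact: cmu.
exact: coord_continuous.
Qed.

Lemma measurable_nll mu y : is_decoder mu -> measurable_fun setT (nll mu y).
Proof.
move=> dmu; apply: measurable_funM => //; apply: measurableT_comp => //.
apply: measurableT_comp => //; apply: measurable_prod => k _.
have mk := measurable_decoder k dmu.
by apply: measurable_funM; apply: measurable_funX => //; exact: measurable_funB.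
Qed.

Lemma nll_ge0 mu y z : is_decoder mu -> 0 <= nll mu y z.
Proof.
by move=> [_ mu01]; rewrite mulr_ge0// oppr_ge0 ln_bernoulli_lik_le0.
Qed.

(** Adding and subtracting [p - q], which integrates to 0, turns the integrand into minus a sum of
    two nonnegative functions; the integral then splits even if a part is infinite. *)
Lemma elboE mu y : is_decoder mu ->
  elbo p q mu y = (- (\int[leb]_z kl_gap y z + \int[leb]_z (nll mu y z)%:E))%E.
Proof.
move=> dmu; have [_ mu01] := dmu.
have integrandE z : ((q y z)%:E * (lne (bernoulli_lik (mu z) y)%:E +
    lne (p z)%:E - lne (q y z)%:E) =
    (p z - q y z)%:E - (kl_gap y z + (nll mu y z)%:E))%E.
  rewrite lne_EFin ?bernoulli_lik_gt0// /nll /kl_gap.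
  have [->|q0] := eqVneq (q y z) 0.
    by rewrite !mul0e mul0r adde0 sube0 subr0 -EFinB subrr.
  have {}q0 : 0 < q y z by rewrite lt0r q0 q_ge0.
  have [->|p0] := eqVneq (p z) 0.
    by rewrite le0_lneNy// lne_EFin//= gt0_muleNy ?lte_fin.
  have {}p0 : 0 < p z by rewrite lt0r p0 p_ge0.
  rewrite !lne_EFin//.
  by apply: (congr1 (@EFin R)) => /=; ring.
rewrite /elbo; under eq_integral do rewrite integrandE.
have pq : leb.-integrable setT (EFin \o (fun z => p z - q y z)).
  rewrite (_ : _ \o _ = (EFin \o p) \- (EFin \o q y))%E.
    by apply: integrableB => //; exact: is_density_integrable.
  by apply/funext.
rewrite integral_nonnegB//; last 2 first.
- apply: emeasurable_funD; first exact: measurable_kl_gap.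
  by apply/measurable_EFinP; exact: measurable_nll.
- by move=> z; rewrite adde_ge0 ?kl_gap_ge0// lee_fin nll_ge0.
rewrite [X in (X - _)%E](_ : _ = 0%E); last first.
  rewrite integralB_EFin ?is_density_integrable//.
  by have [_ _ ->] := p_density; have [_ _ ->] := q_density y; rewrite subee.
rewrite add0e ge0_integralD//.
- by move=> z _; exact: kl_gap_ge0.
- exact: measurable_kl_gap.
- by move=> z _; rewrite lee_fin nll_ge0.
- by apply/measurable_EFinP; exact: measurable_nll.
Qed.

(** Only the last integral depends on [mu], so maximizing the objective will amount to minimizing
    it. *)
Lemma objectiveE mu : is_decoder mu ->
  objective (empirical R x) p q mu =
  (- (N%:R^-1%:E * (\sum_(i < N) \int[leb]_z kl_gap (x i) z +
                    \int[leb]_z (total_nll mu z)%:E)))%E.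
Proof.
move=> dmu; rewrite /objective.
have kl0 y : (0 <= \int[leb]_z kl_gap y z)%E.
  by apply: integral_ge0 => z _; exact: kl_gap_ge0.
have nll0 y : (0 <= \int[leb]_z (nll mu y z)%:E)%E.
  by apply: integral_ge0 => z _; rewrite lee_fin nll_ge0.
under eq_integral do rewrite elboE//.
rewrite integral_ge0N => [|y _]; last exact: adde_ge0.
rewrite ge0_integral_empirical; last 2 first.
- exact: measurable_tuple_bool.
- by move=> y; exact: adde_ge0.
congr (- (_ * _))%E; rewrite big_split/=; congr (_ + _)%E.
under [RHS]eq_integral do rewrite -sumEFin.
rewrite ge0_integral_sum// => [i|i z _]; last by rewrite lee_fin nll_ge0.
by apply/measurable_EFinP; exact: measurable_nll.
Qed.

Lemma total_nll_ge0 mu z : is_decoder mu -> 0 <= total_nll mu z.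
Proof. by move=> dmu; apply: sumr_ge0 => i _; exact: nll_ge0. Qed.

Lemma measurable_total_nll mu : is_decoder mu -> measurable_fun setT (total_nll mu).
Proof. by move=> dmu; apply: measurable_sum => i; exact: measurable_nll. Qed.

Context (N_gt0 : (0 < N)%N) (objective_proper :
  exists2 mu, is_decoder mu & (-oo < objective (empirical R x) p q mu)%E).

(** Two nonnegative terms scaled by the positive [N%:R^-1] have a finite total only if both are
    finite. *)
Let properE : (\sum_(i < N) \int[leb]_z kl_gap (x i) z)%E \is a fin_num /\
  exists2 mu, is_decoder mu & (\int[leb]_z (total_nll mu z)%:E < +oo)%E.
Proof.
have [mu dmu] := objective_proper.
have kl0 : (0 <= \sum_(i < N) \int[leb]_z kl_gap (x i) z)%E.
  by apply: sume_ge0 => i _; apply: integral_ge0 => z _; exact: kl_gap_ge0.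
have nll0 : (0 <= \int[leb]_z (total_nll mu z)%:E)%E.
  by apply: integral_ge0 => z _; rewrite lee_fin total_nll_ge0.
rewrite objectiveE// lteNr/= => h.
have {}h : (\sum_(i < N) \int[leb]_z kl_gap (x i) z +
    \int[leb]_z (total_nll mu z)%:E < +oo)%E.
  rewrite ltNge leye_eq; apply/negP => /eqP e; move: h.
  by rewrite e gt0_muley ?ltxx// lte_fin invr_gt0 ltr0n.
split; last first.
  by exists mu => //; apply: le_lt_trans h; exact: leeDr.
by rewrite ge0_fin_numE//; apply: le_lt_trans h; exact: leeDl.
Qed.

(** The Kullback-Leibler sum is common to both sides and can be cancelled because it is finite; the
    outer minus sign reverses the order. *)
Lemma le_objective mu nu : is_decoder mu -> is_decoder nu ->
  (objective (empirical R x) p q nu <= objective (empirical R x) p q mu)%E =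
  (\int[leb]_z (total_nll mu z)%:E <= \int[leb]_z (total_nll nu z)%:E)%E.
Proof.
move=> dmu dnu; have [klfin _] := properE.
have N0 : (0 < N%:R^-1%:E :> \bar R)%E by rewrite lte_fin invr_gt0 ltr0n.
by rewrite !objectiveE// leeN2 lee_pmul2l// leeD2lE.
Qed.

Lemma optimal_total_nll_fin mu : is_optimal_decoder (empirical R x) p q mu ->
  (\int[leb]_z (total_nll mu z)%:E < +oo)%E.
Proof.
move=> [dmu opt]; have [_ [mu0 dmu0]] := properE.
by apply: le_lt_trans; rewrite -(le_objective dmu dmu0); exact: opt.
Qed.

End objective.

(** * First-order condition *)

Lemma continuous_row (R : realType) (T : topologicalType) (K : nat)
    (f : T -> 'rV[R]_K) :
  (forall k, continuous (fun z => f z 0 k)) -> continuous f.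
Proof.
move=> cf z; apply/cvg_ballP => e e0.
have : \forall t \near z, forall k, ball (f z 0 k) e (f t 0 k).
  by apply: filter_forall => k; have /cvg_ballP := cf k z; exact.
by apply: filterS => t ft; split => // i k; rewrite ord1.
Qed.

Lemma continuous_residual_term (R : realType) (T : topologicalType) (K : nat) (k : 'I_K)
    (f : T -> 'rV[R]_K) (g : T -> R) (a : R) : continuous f -> continuous g ->
  continuous (fun z => g z * (a - f z 0 k)).
Proof.
move=> cf cg z; apply: cvgM; first exact: cg.
apply: cvgB; first exact: cvg_cst.
by apply: (@continuous_comp _ _ _ f (fun m : 'rV[R]_K => m 0 k)); [exact: cf|exact: coord_continuous].
Qed.

Lemma continuous_perturb (R : realType) (T : topologicalType) (K : nat) (k : 'I_K)
    (f : T -> 'rV[R]_K) (u : T -> R) : continuous f -> continuous u ->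
  continuous (fun z => f z + (u z * (f z 0 k * (1 - f z 0 k))) *: delta_mx 0 k).
Proof.
move=> cf cu.
have cfj j : continuous (fun z => f z 0 j).
  move=> z; apply: (@continuous_comp _ _ _ f (fun m : 'rV[R]_K => m 0 j)).
    exact: cf.
  exact: coord_continuous.
apply: continuous_row => j.
rewrite (_ : (fun z => _) = (fun z => f z 0 j +
    (u z * (f z 0 k * (1 - f z 0 k))) * (j == k)%:R)); last first.
  by apply/funext => z; rewrite !mxE eqxx.
move=> z; apply: cvgD; first exact: cfj.
apply: cvgMl; apply: cvgM; first exact: cu.
apply: cvgM; first exact: cfj.
by apply: cvgB; [exact: cvg_cst|exact: cfj].
Qed.

Section first_order.
Context (R : realType) (n K N : nat) (x : 'I_N -> K.-tuple bool).
Context (q : K.-tuple bool -> 'rV[R]_n -> R).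
Implicit Types (mu nu : 'rV[R]_n -> 'rV[R]_K) (z : 'rV[R]_n) (k : 'I_K).
Local Notation leb := (lebesgue_rV R n).

(* The denominator-free form of the first-order condition. *)
Definition residual mu k z : R :=
  \sum_(i < N) q (x i) z * (obs_vec R (x i) 0 k - mu z 0 k).

Lemma residualE mu k z : residual mu k z =
  \sum_(i < N) q (x i) z * obs_vec R (x i) 0 k - (\sum_(i < N) q (x i) z) * mu z 0 k.
Proof.
by rewrite mulr_suml -sumrB; apply: eq_bigr => i _; rewrite mulrBr.
Qed.

(** By [residualE], the residual is the total density times the gap between the weighted mean and
    [mu]; positivity allows the division. *)
Lemma residual_eq0P mu z : 0 < \sum_(j < N) q (x j) z ->
  (forall k, residual mu k z = 0) <->
  mu z = \sum_(i < N) weight x q i z *: obs_vec R (x i).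
Proof.
move=> S0.
have meanE k : (\sum_(i < N) weight x q i z *: obs_vec R (x i)) 0 k =
    (\sum_(i < N) q (x i) z * obs_vec R (x i) 0 k) / (\sum_(j < N) q (x j) z).
  rewrite summxE mulr_suml; apply: eq_bigr => i _.
  by rewrite mxE /weight mulrAC.
split => [r0|muE k].
  apply/rowP => k; rewrite meanE.
  by have := r0 k; rewrite residualE => /subr0_eq ->; rewrite mulrAC divff ?gt_eqF// mul1r.
by rewrite residualE muE meanE mulrC divfK ?gt_eqF// subrr.
Qed.

Context (q_density : forall y, is_density (q y)).

Let q_ge0 y z : 0 <= q y z. Proof. by have [_ ? _] := q_density y. Qed.
Let mq y : measurable_fun setT (q y). Proof. by have [] := q_density y. Qed.

(** Where every posterior density vanishes, the residual condition is automatic, so it constrains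
    [mu] only where the weights are meaningful. *)
Lemma residual_sum0 mu k z : ~ 0 < \sum_(j < N) q (x j) z -> residual mu k z = 0.
Proof.
move=> /negP; rewrite -leNgt => S0; have /psumr_eq0P q0 : \sum_(j < N) q (x j) z = 0.
  by apply/eqP; rewrite eq_le S0 sumr_ge0.
by rewrite /residual big1// => i _; rewrite q0 ?mul0r.
Qed.

Lemma total_nll_tangent mu nu z : is_decoder mu -> is_decoder nu ->
  (forall k, residual mu k z = 0) -> total_nll x q mu z <= total_nll x q nu z.
Proof.
move=> [_ mu01] [_ nu01] r0.
(* These coefficients of the tangent do not depend on the data point [i], so the summed linear term
   is a combination of residuals. *)
pose c k := (nu z 0 k - mu z 0 k) / (mu z 0 k * (1 - mu z 0 k)).
suff : total_nll x q mu z - \sum_(k < K) c k * residual mu k z <= total_nll x q nu z.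
  by rewrite big1 ?subr0// => k _; rewrite r0 mulr0.
have -> : \sum_(k < K) c k * residual mu k z = \sum_(i < N) q (x i) z *
    \sum_(k < K) c k * (obs_vec R (x i) 0 k - mu z 0 k).
  under eq_bigr do rewrite mulr_sumr; rewrite exchange_big/=.
  by apply: eq_bigr => i _; rewrite mulr_sumr; apply: eq_bigr => k _; rewrite mulrCA.
rewrite -sumrB; apply: ler_sum => i _; rewrite -mulrBr ler_wpM2l//.
rewrite -opprD lerN2; exact: ln_bernoulli_lik_tangent.
Qed.

Lemma total_nll_perturb mu k (u : 'rV[R]_n -> R) (v : R) :
  is_decoder mu -> continuous u -> (forall z, `|u z| <= v) -> v <= 2^-1 ->
  exists2 nu, is_decoder nu & forall z, total_nll x q nu z <=
    total_nll x q mu z - u z * residual mu k z +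
    2 * v ^+ 2 * \sum_(i < N) q (x i) z.
Proof.
move=> [cmu mu01] cu uv v2.
exists (fun z => mu z + (u z * (mu z 0 k * (1 - mu z 0 k))) *: delta_mx 0 k).
  split; last first.
    (* The bounds on the perturbed mean come from a lemma that also takes an observation; any one
       will do. *)
    move=> z j; have y : K.-tuple bool by exact: [tuple of nseq K true].
    by have [+ _] := ln_bernoulli_lik_perturb k y (mu01 z) (uv z) v2; exact.
  exact: continuous_perturb.
move=> z; rewrite /residual !mulr_sumr -sumrB -big_split/=; apply: ler_sum => i _.
have [_ h] := ln_bernoulli_lik_perturb k (x i) (mu01 z) (uv z) v2.
rewrite /nll; move: h; set a := ln _; set b := ln _ => h.
have := q_ge0 (x i) z; nra.
Qed.

Lemma continuous_residual mu k : continuous mu ->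
  (forall i, continuous (q (x i))) -> continuous (residual mu k).
Proof.
move=> cmu cq; rewrite /residual; apply: continuous_big => [|i _].
  by move=> z; exact: add_continuous.
exact: continuous_residual_term.
Qed.

Lemma measurable_residual mu k : is_decoder mu -> measurable_fun setT (residual mu k).
Proof.
move=> dmu; apply: measurable_sum => i; apply: measurable_funM => //.
by apply: measurable_funB => //; exact: measurable_decoder.
Qed.

(** Both [obs_vec] and [mu] have components in [0, 1], so the residual is dominated by the
    integrable total density. *)
Lemma integrable_residual mu k : is_decoder mu ->
  leb.-integrable setT (EFin \o residual mu k).
Proof.
move=> dmu; have [_ mu01] := dmu.
have qi : leb.-integrable setT (fun z => \sum_(i < N) (q (x i) z)%:E)%E.
  by apply: integrable_sum => // i _; exact: is_density_integrable.
apply: le_integrable qi => //; first by apply/measurable_EFinP; exact: measurable_residual.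
move=> z _; rewrite /= sumEFin abse_EFin lee_fin.
rewrite (ger0_norm (sumr_ge0 _ _))//; apply: (le_trans (ler_norm_sum _ _ _)).
apply: ler_sum => i _; rewrite normrM (ger0_norm (q_ge0 _ _)) ler_piMr//.
have /andP[m0 m1] := mu01 z k; rewrite obs_vecE ler_norml.
by case: (tnth _ _) => /=; apply/andP; split; lra.
Qed.

Lemma integrable_mul_residual mu k (psi : 'rV[R]_n -> R) : is_decoder mu ->
  continuous psi -> (forall z, `|psi z| <= 1) ->
  leb.-integrable setT (EFin \o (fun z => psi z * residual mu k z)).
Proof.
move=> dmu cpsi psi1; have ri := integrable_residual k dmu.
apply: le_integrable ri => //.
  apply/measurable_EFinP; apply: measurable_funM.
    exact: continuous_measurable_rV.
  exact: measurable_residual.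
by move=> z _; rewrite /= lee_fin normrM ler_piMl.
Qed.

End first_order.

(** Write [J] for the integral and [c] for that of the total density. Perturbing by [t * psi] and
    using minimality gives [0 <= 2 t^2 c - t J], that is [J <= 2 t c] for small positive [t]. The
    one-sided bound suffices because [- psi] is also admissible. *)
Lemma minimal_integral_residual_le0 (R : realType) (n K N : nat)
    (x : 'I_N -> K.-tuple bool) (q : K.-tuple bool -> 'rV[R]_n -> R)
    (mu : 'rV[R]_n -> 'rV[R]_K) (k : 'I_K) (psi : 'rV[R]_n -> R) :
  (forall y, is_density (q y)) -> is_decoder mu ->
  (\int[lebesgue_rV R n]_z (total_nll x q mu z)%:E < +oo)%E ->
  (forall nu, is_decoder nu -> \int[lebesgue_rV R n]_z (total_nll x q mu z)%:E <=
     \int[lebesgue_rV R n]_z (total_nll x q nu z)%:E)%E ->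
  continuous psi -> (forall z, `|psi z| <= 1) ->
  (\int[lebesgue_rV R n]_z (psi z * residual x q mu k z)%:E <= 0)%E.
Proof.
move=> dq dmu muoo mumin cpsi psi1; set leb := lebesgue_rV R n.
pose L := total_nll x q mu; pose h z := psi z * residual x q mu k z.
pose S z := \sum_(i < N) q (x i) z.
have q0 y z : 0 <= q y z by have [_ ? _] := dq y.
have S0 z : 0 <= S z by exact: sumr_ge0.
have L0 z : 0 <= L z by exact: total_nll_ge0.
have Li : leb.-integrable setT (EFin \o L).
  apply/integrableP; split; first by apply/measurable_EFinP; exact: measurable_total_nll.
  by under eq_integral do rewrite gee0_abs ?lee_fin//.
have hi : leb.-integrable setT (EFin \o h) by
  exact: integrable_mul_residual.
have Si : leb.-integrable setT (EFin \o S).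
  rewrite (_ : _ \o _ = fun z => \sum_(i < N) (q (x i) z)%:E)%E.
    by apply: integrable_sum => // i _; exact: is_density_integrable.
  by apply/funext => z; rewrite /= sumEFin.
have /fineK hE := integrable_fin_num measurableT hi.
have /fineK SE := integrable_fin_num measurableT Si.
move: (fine _) hE => J hE; move: (fine _) SE => c SE.
have c0 : 0 <= c by rewrite -lee_fin SE integral_ge0// => z _; rewrite lee_fin.
have small t : 0 < t -> t <= 2^-1 -> J <= 2 * t * c.
  move=> t0 t2.
  have [|||nu dnu nuL] := total_nll_perturb x dq k (u := fun z => t * psi z) (v := t) dmu.
  - by move=> z; apply: continuousM; [apply: cst_continuous|exact: cpsi].
  - by move=> z; rewrite normrM gtr0_norm// ler_piMr// ltW.
  - by [].
  (* An integrable bound for the increase of the loss from [mu] to [nu]; the finite integral of [L]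
     can then be cancelled. *)
  pose w z := 2 * t ^+ 2 * S z - t * h z.
  have wi : leb.-integrable setT (EFin \o w).
    rewrite (_ : _ \o _ = (fun z => (2 * t ^+ 2)%:E * (S z)%:E) \-
                          (fun z => t%:E * (h z)%:E))%E; last by apply/funext.
    by apply: integrableB => //; apply: integrableZl.
  have : (\int[leb]_z (L z)%:E <= \int[leb]_z (L z)%:E + \int[leb]_z (w z)%:E)%E.
    rewrite -integralD_EFin//; apply: le_trans (mumin nu dnu) _.
    apply: ge0_le_integral => //.
    - by move=> z _; rewrite lee_fin total_nll_ge0.
    - by apply/measurable_EFinP; exact: measurable_total_nll.
    - apply: emeasurable_funD; [exact: measurable_int Li|exact: measurable_int wi].
    - move=> z _; rewrite -EFinD lee_fin; apply: le_trans (nuL z) _.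
      by rewrite /w /h /L -/(S z); lra.
  rewrite -[leLHS]adde0 leeD2lE ?(integrable_fin_num measurableT Li)//.
  rewrite (_ : \int[leb]_z (w z)%:E = (2 * t ^+ 2 * c - t * J)%:E)%E.
    by rewrite lee_fin; nra.
  rewrite (integralB_EFin measurableT (f1 := fun z => 2 * t ^+ 2 * S z) (f2 := fun z => t * h z)).
  - under eq_integral do rewrite EFinM; rewrite integralZl// -SE.
    by under eq_integral do rewrite EFinM; rewrite integralZl// -hE.
  - by rewrite (_ : _ \o _ = fun z => (2 * t ^+ 2)%:E * (S z)%:E)%E//; exact: integrableZl.
  - by rewrite (_ : _ \o _ = fun z => t%:E * (h z)%:E)%E//; exact: integrableZl.
rewrite -hE lee_fin leNgt; apply/negP => J0.
(* If [J > 0], the choice [t = J / (4 (c + 1 + J))] is at most [1 / 4] and makes [2 t c] smaller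
   than [J], a contradiction. *)
have D0 : 0 < 4 * (c + 1 + J) by lra.
have tD : J / (4 * (c + 1 + J)) * (4 * (c + 1 + J)) = J by rewrite divfK ?gt_eqF.
have t0 : 0 < J / (4 * (c + 1 + J)) by exact: divr_gt0.
have t2 : J / (4 * (c + 1 + J)) <= 2^-1 by rewrite ler_pdivrMr//; lra.
have := small _ t0 t2; move: tD t0; set t := J / _ => tD t0; nra.
Qed.

Lemma optimal_decoder_residual (R : realType) (n K N : nat)
    (x : 'I_N -> K.-tuple bool) (p : 'rV[R]_n -> R)
    (q : K.-tuple bool -> 'rV[R]_n -> R) (mu : 'rV[R]_n -> 'rV[R]_K) :
  (0 < N)%N -> is_density p -> (forall y, is_density (q y)) ->
  (exists2 mu, is_decoder mu & (-oo < objective (empirical R x) p q mu)%E) ->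
  is_decoder mu ->
  is_optimal_decoder (empirical R x) p q mu <->
  {ae lebesgue_rV R n, forall z, forall k, residual x q mu k z = 0}.
Proof.
move=> N0 dp dq proper dmu; split=> [opt|r0].
  have muoo := optimal_total_nll_fin dp dq N0 proper opt.
  have mumin nu : is_decoder nu ->
      (\int[lebesgue_rV R n]_z (total_nll x q mu z)%:E <=
       \int[lebesgue_rV R n]_z (total_nll x q nu z)%:E)%E.
    move=> dnu; rewrite -(le_objective dp dq N0 proper dmu dnu).
    by case: opt => _ /(_ nu dnu).
  apply: filter_forall => k.
  apply: integral_eq0_rV; first exact: integrable_residual.
  move=> psi cpsi psi1; apply/eqP; rewrite eq_le.
  rewrite (minimal_integral_residual_le0 k dq dmu muoo mumin cpsi psi1)/=.
  have hi : (lebesgue_rV R n).-integrable setT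
      (EFin \o (fun z => psi z * residual x q mu k z)).
    exact: integrable_mul_residual.
  (* The opposite inequality is the same bound for [- psi]. *)
  have := minimal_integral_residual_le0 k dq dmu muoo mumin
    (psi := fun z => - psi z).
  under eq_integral do rewrite mulNr -mulN1r EFinM.
  rewrite integralZl// EFinN mulN1e leeNl oppe0; apply.
    by move=> z; apply: continuousN; exact: cpsi.
  by move=> z; rewrite normrN.
split; first exact: dmu.
move=> nu dnu; rewrite (le_objective dp dq N0 proper dmu dnu).
(* Vanishing residuals give the pointwise inequality of losses by [total_nll_tangent], hence that of
   the integrals. *)
apply: ae_ge0_le_integral => //.
- by move=> z _; rewrite lee_fin total_nll_ge0.
- by apply/measurable_EFinP; exact: measurable_total_nll.
- by move=> z _; rewrite lee_fin total_nll_ge0.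
- by apply/measurable_EFinP; exact: measurable_total_nll.
- by apply: filterS r0 => z r0 _; rewrite lee_fin total_nll_tangent.
Qed.

Theorem proposition2 (R : realType) (n K N : nat) (N_gt0 : (0 < N)%N)
    (x : 'I_N -> K.-tuple bool)
    (p : 'rV[R]_n -> R) (q : K.-tuple bool -> 'rV[R]_n -> R)
    (p_density : is_density p) (q_density : forall y, is_density (q y))
    (objective_proper : exists2 mu : 'rV[R]_n -> 'rV[R]_K,
       is_decoder mu & (-oo < objective (empirical R x) p q mu)%E) :
  [/\ forall z, 0 < \sum_(j < N) q (x j) z ->
        \sum_(i < N) weight x q i z = 1,
      forall mu : 'rV[R]_n -> 'rV[R]_K, is_decoder mu ->
        (is_optimal_decoder (empirical R x) p q mu <->
         {ae lebesgue_rV R n, forall z, 0 < \sum_(j < N) q (x j) z ->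
            mu z = \sum_(i < N) weight x q i z *: obs_vec R (x i)}) &
      forall mu : 'rV[R]_n -> 'rV[R]_K,
        is_optimal_decoder (empirical R x) p q mu ->
        (forall j, continuous (q (x j))) ->
        forall z, 0 < \sum_(j < N) q (x j) z ->
          mu z = \sum_(i < N) weight x q i z *: obs_vec R (x i)].
Proof.
split=> [z S0|mu dmu|mu opt cq z S0].
- by rewrite -mulr_suml divff// gt_eqF.
- rewrite (optimal_decoder_residual N_gt0 p_density q_density objective_proper dmu).
  split; apply: filterS => z.
    by move=> r0 S0; apply/residual_eq0P.
  move=> muE k; have [S0|S0] := pselect (0 < \sum_(j < N) q (x j) z).
    by move: k; apply/residual_eq0P => //; exact: muE.
  exact: residual_sum0.
- have dmu := opt.1.
  (* Pass from [mu] to its residuals: they are continuous on the whole space, whereas the weights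
     are meaningful only where the denominator is positive. *)
  apply/(residual_eq0P _ S0) => k; apply: continuous_ae_eq0; last first.
    have /(optimal_decoder_residual N_gt0 p_density q_density objective_proper dmu) := opt.
    by apply: filterS => y; exact.
  by apply: continuous_residual => //; exact: dmu.1.
Qed.
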